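(* Let $\alpha : I \to \mathbb{R}^3$ be a curve with curvature greater than zero. Then $\alpha$ is a geodesic curve on some (right) circular cone with vertex at the origin if and only if $\alpha$ is a rectifying curve and at the same time a slant helix.
   Context: $I\subseteq\mathbb{R}$ is an open interval; curves are smooth and regular. The notions below are stated for curves parametrized by arc length; a regular curve is said to have one of these properties if its arc length reparametrization does. Frenet frame: for a unit speed curve $\alpha$ with positive curvature $\kappa$, put $\mathbf{t}=\alpha'$, $\mathbf{n}=\alpha''/\kappa$, $\mathbf{b}=\mathbf{t}\times\mathbf{n}$. Rectifying curve: a unit speed curve $\alpha$ with positive curvature whose position vector always lies in its rectifying plane, i.e. $\alpha(s)\in\operatorname{span}\{\mathbf{t}(s),\mathbf{b}(s)\}$ for all $s$. Slant helix: a unit speed curve with nonzero curvature whose principal normal lines make a constant angle with a fixed direction, i.e. there is a fixed unit vector $U\in\mathbb{R}^3$ such that $\langle\mathbf{n}(s),U\rangle$ is constant in $s$. Cone with vertex at the origin: given a regular curve $\mathbf{y}=\mathbf{y}(t)$ defined on an open interval and lying on the unit sphere centered at $0\in\mathbb{R}^3$, the cone $C_{\mathbf{y}}$ over $\mathbf{y}$ is the parametrized surface $C_{\mathbf{y}}(t,u)=u\,\mathbf{y}(t)$, $u\in\mathbb{R}^+=(0,\infty)$, with unit normal $\mathbf{N}(t,u)$ parallel to $\mathbf{y}(t)\times\mathbf{y}'(t)$. The cone is (right) circular if $\mathbf{y}$ makes a constant angle with a fixed unit vector $U$, i.e. $\langle\mathbf{y}(t),U\rangle=\cos\psi_0$ for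 all $t$, for some constant $\psi_0$ with $0<\psi_0<\frac{\pi}{2}$. Curve on the cone: a curve of the form $\alpha(s)=u(s)\,\mathbf{y}(t(s))$ with $u>0$ and $t$ smooth functions of $s$. A unit speed curve on the cone is a geodesic if $\alpha''(s)$ is parallel to $\mathbf{N}(t(s),u(s))$ for all $s$ (zero is allowed). *)

(* Defs.v *)
From HB Require Import structures.
From mathcomp Require Import all_boot all_order all_algebra.
From mathcomp Require Import all_classical all_reals all_analysis.
Set Implicit Arguments.
Unset Strict Implicit.
Unset Printing Implicit Defensive.
Import Order.TTheory GRing.Theory Num.Theory.
Import numFieldNormedType.Exports.
Local Open Scope classical_set_scope.
Local Open Scope ring_scope.

(* Euclidean structure of R^3.  The library norm `|u| on 'rV[R]_3 is the
   maximum norm, so the Euclidean norm is defined separately. *)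
Definition dot (R : realType) (u v : 'rV[R]_3) : R := (u *m v^T) 0 0.

Definition enorm (R : realType) (u : 'rV[R]_3) : R := Num.sqrt (dot u u).

(* Index arithmetic takes place in 'I_3, that is, modulo 3. *)
Definition cross (R : realType) (u v : 'rV[R]_3) : 'rV[R]_3 :=
  \row_(i < 3) (u 0 (i + 1) * v 0 (i + 2) - u 0 (i + 2) * v 0 (i + 1)).

Definition open_interval (R : realType) (I : set R) : Prop :=
  [/\ I !=set0, open I & is_interval I].

(* Functions on an open interval are represented by total functions; only
   their values on the interval matter, derivatives being local. *)
Definition smooth_on (R : realType) (V : normedModType R) (I : set R)
    (f : R -> V) : Prop :=
  forall (n : nat) (t : R), I t -> derivable (derive1n n f) t 1.

Definition regular_curve (R : realType) (I : set R) (a : R -> 'rV[R]_3) : Prop :=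
  smooth_on I a /\ forall t, I t -> derive1 a t != 0.

Definition unit_speed (R : realType) (I : set R) (a : R -> 'rV[R]_3) : Prop :=
  smooth_on I a /\ forall s, I s -> enorm (derive1 a s) = 1.

(* phi is an orientation preserving change of parameter from J onto I. *)
Definition reparametrization (R : realType) (J I : set R) (phi : R -> R) : Prop :=
  [/\ open_interval J, smooth_on J phi, forall s, J s -> 0 < derive1 phi s
    & phi @` J = I].

(* A property P of unit speed curves, transferred to regular curves.  The arc
   length reparametrization is unique up to a translation of the parameter,
   and the properties below are invariant under such translations. *)
Definition by_arc_length (R : realType)
    (P : set R -> (R -> 'rV[R]_3) -> Prop)
    (I : set R) (a : R -> 'rV[R]_3) : Prop :=
  exists (J : set R) (phi : R -> R),
    [/\ reparametrization J I phi, unit_speed J (a \o phi) & P J (a \o phi)].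

(* The formulas down to binormal are meaningful only for unit speed curves. *)
Definition curvature (R : realType) (a : R -> 'rV[R]_3) (s : R) : R :=
  enorm (derive1n 2 a s).

Definition tangent (R : realType) (a : R -> 'rV[R]_3) (s : R) : 'rV[R]_3 :=
  derive1 a s.

Definition principal_normal (R : realType) (a : R -> 'rV[R]_3) (s : R) :
    'rV[R]_3 :=
  (curvature a s)^-1 *: derive1n 2 a s.

Definition binormal (R : realType) (a : R -> 'rV[R]_3) (s : R) : 'rV[R]_3 :=
  cross (tangent a s) (principal_normal a s).

Definition positive_curvature (R : realType) (I : set R) (a : R -> 'rV[R]_3) :
    Prop :=
  forall s, I s -> 0 < curvature a s.

Definition rectifying (R : realType) (I : set R) (a : R -> 'rV[R]_3) : Prop :=
  [/\ unit_speed I a, positive_curvature I a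
    & forall s, I s -> exists l m : R,
        a s = l *: tangent a s + m *: binormal a s].

Definition slant_helix (R : realType) (I : set R) (a : R -> 'rV[R]_3) : Prop :=
  [/\ unit_speed I a, forall s, I s -> curvature a s != 0
    & exists (U : 'rV[R]_3) (c : R), enorm U = 1 /\
        forall s, I s -> dot (principal_normal a s) U = c].

(* The cone over y, with vertex at the origin; it is used for u > 0. *)
Definition cone (R : realType) (y : R -> 'rV[R]_3) (t u : R) : 'rV[R]_3 :=
  u *: y t.

(* The unit normal of the cone at (t, u); it does not depend on u. *)
Definition cone_normal (R : realType) (y : R -> 'rV[R]_3) (t : R) : 'rV[R]_3 :=
  (enorm (cross (y t) (derive1 y t)))^-1 *: cross (y t) (derive1 y t).

Definition cone_directrix (R : realType) (K : set R) (y : R -> 'rV[R]_3) :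
    Prop :=
  [/\ open_interval K, regular_curve K y & forall t, K t -> enorm (y t) = 1].

Definition circular_cone (R : realType) (K : set R) (y : R -> 'rV[R]_3) : Prop :=
  cone_directrix K y /\
  exists (U : 'rV[R]_3) (psi0 : R),
    [/\ enorm U = 1, 0 < psi0 < pi / 2
      & forall t, K t -> dot (y t) U = cos psi0].

Definition cone_geodesic (R : realType) (K : set R) (y : R -> 'rV[R]_3)
    (I : set R) (a : R -> 'rV[R]_3) : Prop :=
  unit_speed I a /\
  exists u t : R -> R,
    [/\ smooth_on I u, smooth_on I t,
        forall s, I s -> [/\ 0 < u s, K (t s) & a s = cone y (t s) (u s)]
      & forall s, I s -> exists c : R, derive1n 2 a s = c *: cone_normal y (t s)].

(* Main.v *)
Require Import Defs.
From mathcomp Require Import all_boot all_order all_algebra.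
From mathcomp Require Import all_classical all_reals all_analysis.
From mathcomp Require Import ring.

(** Let b be unit speed with b'' <> 0.  The normal of a cone at a point b of it
    is orthogonal to b, so a geodesic satisfies <b, b''> = 0, that is, it is
    rectifying; on a circular cone the cone normal makes a constant angle with
    the axis, and b'' is parallel to it.
    Conversely, let b be rectifying, x = <b, b'> and p = b x b'.  Then x' = 1,
    |p|^2 = |b|^2 - x^2 is constant and nonzero, and b'' is parallel to p, the
    normal of the cone over y = b / |b|; so b is a geodesic of that cone.  If
    <p, U> is also constant up to sign, then 0 = <p, U>' = <b x b'', U>, and
    since b x b'' is parallel to b x p, hence to y', the angle between y and U
    is constant. *)

Set Implicit Arguments.
Unset Strict Implicit.
Unset Printing Implicit Defensive.
Import Order.TTheory GRing.Theory Num.Theory.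
Import numFieldNormedType.Exports.
Local Open Scope classical_set_scope.
Local Open Scope ring_scope.

(** * Vector algebra in Euclidean three-space *)

Section EuclideanSpace.
Context {R : realType}.
Implicit Types u v w : 'rV[R]_3.

(** The third index is written [1 + 1], the form to which [crossE] brings the index sums modulo
    3. *)
Lemma rV3P u v :
  u 0 0 = v 0 0 -> u 0 1 = v 0 1 -> u 0 (1 + 1) = v 0 (1 + 1) -> u = v.
Proof.
move=> h0 h1 h2; apply/rowP => -[[|[|[|//]]] i3].
- by rewrite (_ : Ordinal i3 = 0) //; exact: val_inj.
- by rewrite (_ : Ordinal i3 = 1) //; exact: val_inj.
- by rewrite (_ : Ordinal i3 = 1 + 1) //; exact: val_inj.
Qed.

Lemma dotE u v :
  dot u v = u 0 0 * v 0 0 + u 0 1 * v 0 1 + u 0 (1 + 1) * v 0 (1 + 1).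
Proof.
rewrite /dot mxE !big_ord_recl big_ord0 addr0 addrA !mxE.
by congr (u _ _ * v _ _ + u _ _ * v _ _ + u _ _ * v _ _); exact: val_inj.
Qed.

Let ord3D11D1 : 1 + 1 + 1 = 0 :> 'I_3. Proof. exact: val_inj. Qed.

Let ord3D2 : 2 = 1 + 1 :> 'I_3. Proof. exact: val_inj. Qed.

Lemma crossE u v :
  (cross u v 0 0 = u 0 1 * v 0 (1 + 1) - u 0 (1 + 1) * v 0 1) *
  (cross u v 0 1 = u 0 (1 + 1) * v 0 0 - u 0 0 * v 0 (1 + 1)) *
  (cross u v 0 (1 + 1) = u 0 0 * v 0 1 - u 0 1 * v 0 0).
Proof. by rewrite !mxE ord3D2 !addrA !add0r !ord3D11D1 !add0r. Qed.

Let vecE := (dotE, crossE).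

Lemma dotC u v : dot u v = dot v u.
Proof. by rewrite !dotE; ring. Qed.

Lemma dotDl u v w : dot (u + v) w = dot u w + dot v w.
Proof. by rewrite !dotE !mxE; ring. Qed.

Lemma dotZl k u v : dot (k *: u) v = k * dot u v.
Proof. by rewrite !dotE !mxE; ring. Qed.

Lemma dotNl u v : dot (- u) v = - dot u v.
Proof. by rewrite !dotE !mxE; ring. Qed.

Lemma dotDr u v w : dot u (v + w) = dot u v + dot u w.
Proof. by rewrite !dotE !mxE; ring. Qed.

Lemma dotZr k u v : dot u (k *: v) = k * dot u v.
Proof. by rewrite !dotE !mxE; ring. Qed.

Lemma dotNr u v : dot u (- v) = - dot u v.
Proof. by rewrite !dotE !mxE; ring. Qed.

Lemma dotv0 u : dot u 0 = 0.
Proof. by rewrite dotE !mxE; ring. Qed.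

Lemma dot_ge0 u : 0 <= dot u u.
Proof. by rewrite dotE -!expr2 !addr_ge0 ?sqr_ge0. Qed.

Lemma dot_eq0 u : (dot u u == 0) = (u == 0).
Proof.
apply/idP/eqP => [|->]; last by rewrite dotE !mxE !mul0r !addr0.
rewrite dotE -!expr2 !paddr_eq0 ?addr_ge0 ?sqr_ge0 // !sqrf_eq0.
by move=> /andP[/andP[/eqP u0 /eqP u1] /eqP u2]; apply: rV3P; rewrite mxE.
Qed.

Lemma dot_gt0 u : (0 < dot u u) = (u != 0).
Proof. by rewrite lt0r dot_eq0 dot_ge0 andbT. Qed.

Lemma enorm_sqr u : enorm u ^+ 2 = dot u u.
Proof. by rewrite sqr_sqrtr // dot_ge0. Qed.

Lemma enorm_gt0 u : (0 < enorm u) = (u != 0).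
Proof. by rewrite sqrtr_gt0 dot_gt0. Qed.

Lemma enorm1P u : enorm u = 1 <-> dot u u = 1.
Proof.
split=> [e|]; first by rewrite -enorm_sqr e expr1n.
by rewrite /enorm => ->; rewrite sqrtr1.
Qed.

Lemma dot_crossl u v : dot u (cross u v) = 0.
Proof. by rewrite !vecE; ring. Qed.

Lemma dot_crossr u v : dot v (cross u v) = 0.
Proof. by rewrite !vecE; ring. Qed.

Lemma cross0v u : cross 0 u = 0.
Proof. by apply: rV3P; rewrite crossE !mxE; ring. Qed.

Lemma crossvv u : cross u u = 0.
Proof. by apply: rV3P; rewrite crossE !mxE; ring. Qed.

Lemma crossC u v : cross u v = - cross v u.
Proof. by apply: rV3P; rewrite [RHS]mxE !crossE; ring. Qed.

Lemma crossZl k u v : cross (k *: u) v = k *: cross u v.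
Proof. by apply: rV3P; rewrite [RHS]mxE !crossE !mxE; ring. Qed.

Lemma crossZr k u v : cross u (k *: v) = k *: cross u v.
Proof. by apply: rV3P; rewrite [RHS]mxE !crossE !mxE; ring. Qed.

Lemma crossDr u v w : cross u (v + w) = cross u v + cross u w.
Proof. by apply: rV3P; rewrite [RHS]mxE !crossE !mxE; ring. Qed.

Lemma cross_crossl u v w :
  cross (cross u v) w = dot u w *: v - dot v w *: u.
Proof. by apply: rV3P; rewrite !crossE !dotE !mxE; ring. Qed.

Lemma dot_cross_cross u v :
  dot (cross u v) (cross u v) = dot u u * dot v v - dot u v ^+ 2.
Proof. by rewrite !vecE; ring. Qed.

(** The square of the triple product is the determinant of the Gram matrix of the three vectors,
    expanded here. It gives the angle of a cross product with an axis from the angles of its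
    factors. *)
Lemma gram_det u v w :
  dot w (cross u v) ^+ 2 = dot w w * dot u u * dot v v
    + dot w u * dot w v * dot u v *+ 2
    - dot w u ^+ 2 * dot v v - dot w v ^+ 2 * dot u u - dot w w * dot u v ^+ 2.
Proof. by rewrite !vecE; ring. Qed.

(** With p = u x v, the product p x w vanishes, so [w] is parallel to p; expanding (p x w) x p = 0
    gives the factor without a division. *)
Lemma orthogonal_frame u v w : dot u w = 0 -> dot v w = 0 ->
  dot (cross u v) (cross u v) *: w = dot w (cross u v) *: cross u v.
Proof.
move=> uw vw; have := cross_crossl (cross u v) w (cross u v).
rewrite (cross_crossl u v w) uw vw !scale0r subrr cross0v => /esym/eqP.
by rewrite subr_eq0 => /eqP.
Qed.

(** The vectors u, v, p = u x v form an orthonormal frame and [w] has no component along [v]. The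
    proof computes (p x w) x p in two ways, using p x w = <u, w> v and v x p = u. *)
Lemma orthonormal_expansion u v w :
  dot u u = 1 -> dot v v = 1 -> dot u v = 0 -> dot w v = 0 ->
  w = dot w u *: u + dot w (cross u v) *: cross u v.
Proof.
move=> uu vv uv wv; set p := cross u v.
have pp : dot p p = 1 by rewrite dot_cross_cross uu vv uv; ring.
have := cross_crossl p w p; rewrite [X in X = _](_ : _ = dot u w *: cross v p);
  last by rewrite (cross_crossl u v w) (dotC v) wv scale0r subr0 crossZl.
rewrite pp.
rewrite scale1r crossC (cross_crossl u v v) uv vv.
by rewrite scale0r sub0r opprK scale1r (dotC u) => ->; rewrite subrK.
Qed.

End EuclideanSpace.

(** * Derivatives of vector functions, and constancy on intervals *)

Section Derivatives.
Context {R : realType}.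

Lemma is_derive_scale (V : normedModType R) (k : R -> R) (f : R -> V) (x dk : R)
    (df : V) :
  is_derive x 1 k dk -> is_derive x 1 f df ->
  is_derive x 1 (fun t => k t *: f t) (k x *: df + dk *: f x).
Proof.
move=> [k_ex kE] [f_ex fE].
suff lim : (fun h : R => h^-1 *: (((fun t => k t *: f t) \o shift x) (h *: 1)
    - k x *: f x)) @ 0^' --> k x *: df + dk *: f x.
  by apply: DeriveDef; [apply/cvg_ex; eexists; exact: lim | exact: cvg_lim lim].
pose g (h : R) := k (h *: 1 + x) *: (h^-1 *: (f (h *: 1 + x) - f x))
  + (h^-1 *: (k (h *: 1 + x) - k x)) *: f x.
rewrite (_ : (fun h : R => _) = g); last first.
  apply/funext => h; rewrite /g /= scalerA [k _ * _]mulrC -scalerA.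
  rewrite -[(h^-1 *: _) *: _]scalerA -scalerDr.
  by congr (_ *: _); rewrite scalerBr scalerBl addrA subrK.
apply: cvgD.
- apply: cvgZ; last by rewrite -fE; exact: f_ex.
  suff : {for 0, continuous (fun h : R => k (h *: 1 + x))}.
    by move=> /continuous_withinNx; rewrite scale0r add0r.
  exact/differentiable_continuous/derivable1_diffP/(derivable1P _ _ _).1.
- by apply: cvgZr_tmp; rewrite -kE; exact: k_ex.
Qed.

Lemma is_derive_chain (V : normedModType R) (f : R -> V) (g : R -> R) (x : R)
    (df : V) (dg : R) :
  is_derive (g x) 1 f df -> is_derive x 1 g dg ->
  is_derive x 1 (f \o g) (dg *: df).
Proof.
move=> [/derivable1_diffP f_diff fE] [/derivable1_diffP g_diff gE].
apply: DeriveDef; first exact/derivable1_diffP/differentiable_comp.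
rewrite -derive1E derive1E'; last exact: differentiable_comp.
rewrite diff_comp //= -[X in 'd f _ X](_ : 'D_1 g x *: 1 = _).
  by rewrite linearZ /= -(derive1E' f_diff) derive1E fE gE.
by rewrite -derive1E derive1E' // [LHS]mulr1.
Qed.

Lemma is_derive_coord m n (f : R -> 'M[R]_(m, n)) (x : R)
    (df : 'M[R]_(m, n)) i j :
  is_derive x 1 f df -> is_derive x 1 (fun t => f t i j) (df i j).
Proof.
move=> [f_ex fE]; apply: DeriveDef; first exact: (derivable_mxP f x 1).1.
by rewrite -fE derive_mx // mxE.
Qed.

Lemma is_derive_dot (f g : R -> 'rV[R]_3) (x : R) (df dg : 'rV[R]_3) :
  is_derive x 1 f df -> is_derive x 1 g dg ->
  is_derive x 1 (fun t => dot (f t) (g t)) (dot df (g x) + dot (f x) dg).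
Proof.
move=> f_x g_x; pose p i j t := f t 0 i * g t 0 j.
have dp i : is_derive x 1 (p i i) (f x 0 i * dg 0 i + g x 0 i * df 0 i).
  by have := is_deriveM (is_derive_coord 0 i f_x) (is_derive_coord 0 i g_x).
rewrite (_ : (fun t => _) = p 0 0 + p 1 1 + p (1 + 1) (1 + 1)); last first.
  by apply/funext => t; rewrite dotE.
by apply: is_derive_eq; rewrite !dotE; ring.
Qed.

Lemma is_derive_mx m n (f : R -> 'M[R]_(m, n)) (x : R) (df : 'M[R]_(m, n)) :
  (forall i j, is_derive x 1 (fun t => f t i j) (df i j)) -> is_derive x 1 f df.
Proof.
move=> dfE.
have f_ex : derivable f x 1 by apply/derivable_mxP => i j; case: (dfE i j).
apply: DeriveDef => //; rewrite derive_mx //; apply/matrixP => i j.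
by rewrite mxE; case: (dfE i j).
Qed.

Lemma is_derive_cross (f g : R -> 'rV[R]_3) (x : R) (df dg : 'rV[R]_3) :
  is_derive x 1 f df -> is_derive x 1 g dg ->
  is_derive x 1 (fun t => cross (f t) (g t)) (cross df (g x) + cross (f x) dg).
Proof.
move=> f_x g_x; apply: is_derive_mx => i k; rewrite ord1 => {i}.
pose p i j t := f t 0 i * g t 0 j.
have dp i j : is_derive x 1 (p i j) (f x 0 i * dg 0 j + g x 0 j * df 0 i).
  by have := is_deriveM (is_derive_coord 0 i f_x) (is_derive_coord 0 j g_x).
rewrite (_ : (fun t => _) = p (k + 1) (k + 2) - p (k + 2) (k + 1)); last first.
  by apply/funext => t; rewrite mxE.
by apply: is_derive_eq; rewrite !mxE; ring.
Qed.

Lemma is_derive_unique (V : normedModType R) (f : R -> V) (x : R) (df df' : V) :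
  is_derive x 1 f df -> is_derive x 1 f df' -> df = df'.
Proof. by move=> [_ <-] [_ <-]. Qed.

Lemma derivable_is_derive1 (V : normedModType R) (f : R -> V) (x : R) :
  derivable f x 1 -> is_derive x 1 f (derive1 f x).
Proof. by move=> fx; rewrite derive1E; exact: derivableP. Qed.

(** Together with [is_derive_unique] this differentiates both sides of an identity known only on the
    open set [I]. *)
Lemma is_derive_eq_in (V : normedModType R) (I : set R) (f g : R -> V) (x : R)
    (df : V) :
  open I -> I x -> (forall t, I t -> f t = g t) ->
  is_derive x 1 f df -> is_derive x 1 g df.
Proof.
move=> I_open Ix fg; apply: near_eq_is_derive.
by apply: filterS (open_nbhs_nbhs (conj I_open Ix)) => t; exact: fg.
Qed.

Lemma is_derive1_continuous (V : normedModType R) (f : R -> V) (x : R)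
    (df : V) :
  is_derive x 1 f df -> {for x, continuous f}.
Proof. by move=> [? _]; exact/differentiable_continuous/derivable1_diffP. Qed.

Lemma constant_on_interval (I : set R) (f : R -> R) (x y : R) :
  is_interval I -> (forall t, I t -> is_derive t 1 f 0) -> I x -> I y ->
  f x = f y.
Proof.
move=> I_itv f0; wlog xy : x y / x <= y => [hw Ix Iy|Ix Iy].
  by case/orP: (le_total x y) => [|] h; [|apply/esym]; exact: hw.
have Izt t : t \in `[x, y] -> I t by rewrite in_itv /=; exact: I_itv.
have [||c _] := @MVT_segment R f (fun=> 0) x y xy.
- by move=> t txy; apply/f0/Izt; exact: subset_itv_oo_cc.
- apply: derivable_within_continuous => z /Izt /f0 [] //.
- by rewrite mul0r => /eqP; rewrite subr_eq0 => /eqP.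
Qed.

(** A change of sign would produce a zero by the intermediate value theorem. *)
Lemma constant_sign_on_interval (I : set R) (f : R -> R) (x y : R) :
  is_interval I -> (forall t, I t -> {for t, continuous f}) ->
  (forall t, I t -> f t != 0) -> I x -> I y -> 0 < f x * f y.
Proof.
move=> I_itv f_cont f_neq0; wlog xy : x y / x <= y => [hw Ix Iy|Ix Iy].
  by case/orP: (le_total x y) => h; [|rewrite mulrC]; exact: hw.
have Ixy t : t \in `[x, y] -> I t by rewrite in_itv /=; exact: I_itv.
rewrite ltNge; apply/negP => fxy_le0.
have [||c cxy fc0] := @IVT R f x y 0 xy.
- by apply: continuous_in_subspaceT => t; rewrite inE => txy; exact/f_cont/Ixy.
- rewrite ge_min le_max; case: (leP (f x) 0) fxy_le0 => [fx_le0|fx_gt0].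
    by have := f_neq0 _ Ix; case: ltgtP fx_le0 => // ? _ _;
      rewrite nmulr_rle0 // => ->; rewrite orbT.
  by rewrite pmulr_rle0 // => ->; rewrite (ltW fx_gt0).
- by have := f_neq0 _ (Ixy _ cxy); rewrite fc0 eqxx.
Qed.

(** Equal squares leave only h x = h y or h x = - h y, and a continuous [g] with the sign of [h]
    excludes the second. Continuity is asked of [g] because in the application [h] is [g] divided by
    the curvature. *)
Lemma constant_of_sqr (I : set R) (g h : R -> R) (c x y : R) :
  is_interval I -> (forall t, I t -> {for t, continuous g}) ->
  (forall t, I t -> 0 < g t * h t) -> (forall t, I t -> h t ^+ 2 = c) ->
  I x -> I y -> h x = h y.
Proof.
move=> I_itv g_cont gh_gt0 h_sqr Ix Iy.
have g_neq0 t : I t -> g t != 0.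
  by move=> /gh_gt0; apply: contraTneq => ->; rewrite mul0r ltxx.
have gg_gt0 := constant_sign_on_interval I_itv g_cont g_neq0 Ix Iy.
have /eqP := etrans (h_sqr x Ix) (esym (h_sqr y Iy)).
rewrite eqf_sqr => /orP[/eqP //|/eqP hN].
have := mulr_gt0 (gh_gt0 x Ix) (gh_gt0 y Iy).
rewrite hN mulrACA pmulr_rgt0 // mulNr oppr_gt0 -expr2.
by rewrite ltNge sqr_ge0.
Qed.

End Derivatives.

(** * Closure properties of smooth functions *)

Section Smoothness.
Context {R : realType}.
Implicit Types (V : normedModType R) (I : set R) (n : nat).

(** The index is shifted: this asks for n + 1 successive derivatives on [I]. Peeling off the first
    derivative lets the product rule be used by induction on [n]. *)
Fixpoint Ck V n I (f : R -> V) : Prop :=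
  (forall t, I t -> derivable f t 1) /\
  (if n is n'.+1 then Ck n' I (derive1 f) else True).

Lemma smooth_onP V I (f : R -> V) : smooth_on I f <-> forall n, Ck n I f.
Proof.
split=> [f_smooth n|f_Ck n t It].
- elim: n f f_smooth => [|n ihn] f f_smooth; split=> //;
    try exact: (f_smooth 0).
  by apply: ihn => k t It; rewrite -derive1Sn; exact: f_smooth.
- have : Ck n I f by [].
  elim: n f {f_Ck} => [|n ihn] f [f_ex f_Ck]; first exact: f_ex.
  by rewrite derive1Sn; exact: ihn.
Qed.

Lemma smooth_on_derive V I (f : R -> V) : smooth_on I f ->
  forall t, I t -> is_derive t 1 f (derive1 f t).
Proof. by move=> f_smooth t It; exact/derivable_is_derive1/(f_smooth 0). Qed.

Lemma smooth_on_derive1 V I (f : R -> V) : smooth_on I f ->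
  smooth_on I (derive1 f).
Proof. by move=> f_smooth n t It; rewrite -derive1Sn; exact: f_smooth. Qed.

Lemma CkW V n I (f : R -> V) : Ck n.+1 I f -> Ck n I f.
Proof.
elim: n f => [|n ihn] f [f_ex f_Ck]; split=> //; exact: ihn.
Qed.

Lemma eq_Ck V n I (f g : R -> V) : open I -> (forall t, I t -> f t = g t) ->
  Ck n I f -> Ck n I g.
Proof.
move=> I_open; elim: n f g => [|n ihn] f g fg [f_ex f_Ck].
  split=> // t It; have /f_ex/derivable_is_derive1 := It.
  by move=> /(is_derive_eq_in I_open It fg)[].
have dg t : I t -> is_derive t 1 g (derive1 f t).
  move=> It; have df := derivable_is_derive1 (f_ex _ It).
  exact: is_derive_eq_in I_open It fg df.
split=> [t /dg[] //|]; apply: ihn f_Ck => t It.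
by case: (dg t It) => _ <-; rewrite derive1E.
Qed.

Lemma CkS V n I (f df : R -> V) : open I ->
  (forall t, I t -> is_derive t 1 f (df t)) -> Ck n I df -> Ck n.+1 I f.
Proof.
move=> I_open dfE df_Ck; split=> [t /dfE[] //|].
by apply: eq_Ck df_Ck => // t /dfE[_ <-]; rewrite derive1E.
Qed.

Lemma Ck_cst V n I (v : V) : Ck n I (fun=> v).
Proof.
elim: n v => [|n ihn] v;
  (split; first by move=> t _; exact: derivable_cst) => //.
by rewrite (_ : derive1 _ = fun=> 0) //; apply/funext => t; exact: derive1_cst.
Qed.

Lemma CkD V n I (f g : R -> V) : open I -> Ck n I f -> Ck n I g ->
  Ck n I (fun t => f t + g t).
Proof.
move=> I_open; elim: n f g => [|n ihn] f g [f_ex f_Ck] [g_ex g_Ck].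
  by split=> // t It; apply: derivableD; [exact: f_ex | exact: g_ex].
apply: (CkS (df := fun t => derive1 f t + derive1 g t)) => // [t It|].
- by apply: is_deriveD; apply: derivable_is_derive1; [exact: f_ex|exact: g_ex].
- exact: ihn.
Qed.

Lemma CkZ V n I (k : R -> R) (f : R -> V) : open I -> Ck n I k -> Ck n I f ->
  Ck n I (fun t => k t *: f t).
Proof.
move=> I_open; elim: n k f => [|n ihn] k f k_Ck f_Ck.
  split=> // t It; have [k_ex _] := k_Ck; have [f_ex _] := f_Ck.
  by have [] := is_derive_scale (derivable_is_derive1 (k_ex _ It))
                                (derivable_is_derive1 (f_ex _ It)).
apply: (CkS (df := fun t => k t *: derive1 f t + derive1 k t *: f t)) => //.
- move=> t It; have [k_ex _] := k_Ck; have [f_ex _] := f_Ck.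
  by apply: is_derive_scale; apply: derivable_is_derive1; auto.
- by apply: CkD => //; apply: ihn; by [exact: CkW | case: k_Ck | case: f_Ck].
Qed.

Lemma CkM n I (k f : R -> R) : open I -> Ck n I k -> Ck n I f ->
  Ck n I (fun t => k t * f t).
Proof. exact: (@CkZ R). Qed.

Lemma smooth_onZ V I (k : R -> R) (f : R -> V) : open I -> smooth_on I k ->
  smooth_on I f -> smooth_on I (fun t => k t *: f t).
Proof.
move=> I_open /smooth_onP k_Ck /smooth_onP f_Ck.
by apply/smooth_onP => n; exact: CkZ.
Qed.

Lemma smooth_on_deriveP V I (f df : R -> V) : open I ->
  (forall t, I t -> is_derive t 1 f (df t)) -> smooth_on I df -> smooth_on I f.
Proof.
move=> I_open dfE /smooth_onP df_Ck; apply/smooth_onP => n.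
exact/CkW/(CkS I_open dfE).
Qed.

Lemma smooth_on_cst V I (v : V) : smooth_on I (fun=> v).
Proof. by apply/smooth_onP => n; exact: Ck_cst. Qed.

Lemma smooth_on_id I : open I -> smooth_on I (fun t : R => t).
Proof.
move=> I_open; apply: (@smooth_on_deriveP R I id (fun=> 1)) => //.
exact: smooth_on_cst.
Qed.

Lemma is_derive_rsqrt (q : R -> R) (t dq : R) : 0 < q t ->
  is_derive t 1 q dq ->
  is_derive t 1 (fun s => (Num.sqrt (q s))^-1)
    (- (dq / 2) * (Num.sqrt (q t))^-1 ^+ 3).
Proof.
move=> q_gt0 dqE; have s_gt0 : 0 < Num.sqrt (q t) by rewrite sqrtr_gt0.
have ds := is_derive_chain (is_derive1_sqrt q_gt0) dqE.
have dr := @is_deriveV R (Num.sqrt \o q) t _ 1 (lt0r_neq0 s_gt0) ds.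
apply: is_derive_eq dr _.
rewrite /GRing.scale /=; field; exact: lt0r_neq0.
Qed.

(* r = q^(-1/2) solves r' = - q' r^3 / 2, so r is C^(n+1) if it is C^n. *)
Lemma smooth_on_rsqrt I (q : R -> R) : open I -> (forall t, I t -> 0 < q t) ->
  smooth_on I q -> smooth_on I (fun t => (Num.sqrt (q t))^-1).
Proof.
move=> I_open q_gt0 q_smooth; set r := fun t => _.
pose dr t := - (derive1 q t / 2) * r t ^+ 3.
have drE t : I t -> is_derive t 1 r (dr t).
  move=> It.
  exact: is_derive_rsqrt (q_gt0 _ It) (smooth_on_derive q_smooth It).
apply/smooth_onP; elim=> [|n ihn]; first by split=> // t /drE[].
apply: (CkS I_open drE).
(* The cube is spelled out as nested products so that [CkM] applies factor by factor. *)
rewrite (_ : dr = fun t => - (1 / 2) * (derive1 q t * (r t * (r t * r t)))).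
  apply: CkM => //; first exact: Ck_cst.
  apply: CkM => //; first by move: n {ihn}; exact/smooth_onP/smooth_on_derive1.
  by do 2! [apply: CkM => //].
by apply/funext => t; rewrite /dr; field.
Qed.

End Smoothness.

(** * Arc length reparametrizations, and geodesics of circular cones *)

Section Curves.
Context {R : realType}.
Implicit Types (I J K : set R) (a b y : R -> 'rV[R]_3).

Lemma dot_const_orth I (f : R -> 'rV[R]_3) (c t : R) (df : 'rV[R]_3) :
  open I -> (forall s, I s -> dot (f s) (f s) = c) -> I t ->
  is_derive t 1 f df -> dot (f t) df = 0.
Proof.
move=> I_open fc It dfE.
have fcC s : I s -> c = dot (f s) (f s) by move=> /fc.
have dc := is_derive_eq_in I_open It fcC (is_derive_cst c t 1).
have := is_derive_unique (is_derive_dot dfE dfE) dc.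
by rewrite (dotC df) => /eqP; rewrite -mulr2n mulrn_eq0 /= => /eqP.
Qed.

Lemma unit_speed_dot I b s : unit_speed I b -> I s ->
  dot (derive1 b s) (derive1 b s) = 1.
Proof. by move=> [_ b_unit] /b_unit /enorm1P. Qed.

Lemma unit_speed_derive I b s : unit_speed I b -> I s ->
  is_derive s 1 b (derive1 b s) /\ is_derive s 1 (derive1 b) (derive1n 2 b s).
Proof.
move=> [b_smooth _] Is; split; first exact: smooth_on_derive b_smooth s Is.
exact: smooth_on_derive (smooth_on_derive1 b_smooth) s Is.
Qed.

Lemma unit_speed_orth I b s : open I -> unit_speed I b -> I s ->
  dot (derive1 b s) (derive1n 2 b s) = 0.
Proof.
move=> I_open b_unit Is; have [_ db1] := unit_speed_derive b_unit Is.
apply: (dot_const_orth (c := 1) I_open _ Is db1) => t It.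
exact: unit_speed_dot It.
Qed.

Lemma curvature_sqr b s :
  curvature b s ^+ 2 = dot (derive1n 2 b s) (derive1n 2 b s).
Proof. exact: enorm_sqr. Qed.

Lemma curvature_gt0 b s : (0 < curvature b s) = (derive1n 2 b s != 0).
Proof. exact: enorm_gt0. Qed.

(** The right-hand side involves [phi] only through the point [phi s]: unit speed determines phi'^2,
    and orthogonality of velocity and acceleration determines phi''. So the acceleration does not
    depend on the choice of arc length parameter. *)
Lemma arc_length_derive2 I J a phi s : smooth_on I a ->
  reparametrization J I phi -> unit_speed J (a \o phi) -> J s ->
  let a1 := derive1 a (phi s) in let a2 := derive1n 2 a (phi s) in
  derive1n 2 (a \o phi) s =
    (dot a1 a1)^-1 *: a2 - ((dot a1 a1)^-1 ^+ 2 * dot a1 a2) *: a1.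
Proof.
move=> a_smooth [[_ J_open _] phi_smooth phi1_gt0 phiJ] b_unit Js a1 a2.
have Iphi t : J t -> I (phi t) by move=> Jt; rewrite -phiJ; exists t.
have da t : J t -> is_derive (phi t) 1 a (derive1 a (phi t)).
  by move=> /Iphi; exact: smooth_on_derive.
have dphi t : J t -> is_derive t 1 phi (derive1 phi t).
  exact: smooth_on_derive.
have b1E t : J t -> derive1 phi t *: derive1 a (phi t) = derive1 (a \o phi) t.
  move=> Jt; apply: is_derive_unique (is_derive_chain (da t Jt) (dphi t Jt)) _.
  by case: (unit_speed_derive b_unit Jt).
have da1 : is_derive (phi s) 1 (derive1 a) a2.
  exact: smooth_on_derive (smooth_on_derive1 a_smooth) _ (Iphi s Js).
have dphi1 := smooth_on_derive (smooth_on_derive1 phi_smooth) Js.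
have [_ db1] := unit_speed_derive b_unit Js.
have b2E := is_derive_unique db1 (is_derive_eq_in J_open Js b1E
  (is_derive_scale dphi1 (is_derive_chain da1 (dphi s Js)))).
have := unit_speed_orth J_open b_unit Js.
have := unit_speed_dot b_unit Js.
rewrite b2E -b1E //= -/a1 !(dotZl, dotZr, dotDr).
move: (derive1 phi s) (derive1 (derive1 phi) s) (phi1_gt0 s Js) => p p2 p_gt0.
have p_neq0 := lt0r_neq0 p_gt0; move=> speed /eqP.
rewrite mulf_eq0 (negPf p_neq0) /= => /eqP orth.
have a11E : dot a1 a1 = p ^- 2.
  by apply: (mulfI p_neq0); apply: (mulfI p_neq0); rewrite speed; field.
(* Orthogonality reads p^2 <a', a''> + p2 <a', a'> = 0, and <a', a'> = p^(-2). *)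
have -> : p2 = - p ^+ 4 * dot a1 a2.
  apply: (mulIf (lt0r_neq0 _ : dot a1 a1 != 0)).
    by rewrite a11E invr_gt0 exprn_gt0.
  apply/eqP; rewrite -subr_eq0; apply/eqP; rewrite -[RHS]orth a11E; field.
  exact: p_neq0.
rewrite a11E invrK scalerA -expr2 mulNr scaleNr; congr (_ - _ *: _).
by rewrite -exprM.
Qed.

(** Curvature and principal normal are functions of the second derivative, so this carries
    statements about them from one arc length reparametrization to another. *)
Lemma arc_length_transfer I J J' a phi psi s : smooth_on I a ->
  reparametrization J I phi -> unit_speed J (a \o phi) ->
  reparametrization J' I psi -> unit_speed J' (a \o psi) -> J s ->
  exists2 s', J' s' & derive1n 2 (a \o phi) s = derive1n 2 (a \o psi) s'.
Proof.
move=> a_smooth phiP phi_unit psiP psi_unit Js.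
have [_ _ _ phiJ] := phiP; have [_ _ _ psiJ] := psiP.
have [s' Js' psis'] : (psi @` J') (phi s) by rewrite psiJ -phiJ; exists s.
exists s'; first exact: Js'.
have -> := arc_length_derive2 a_smooth phiP phi_unit Js.
by have -> := arc_length_derive2 a_smooth psiP psi_unit Js'; rewrite psis'.
Qed.

(** Differentiating |y|^2 = 1 and <y, U> = c shows that y' is orthogonal to y and to U; the Gram
    determinant of y, y', U then gives the angle between normal and axis up to sign. *)
Lemma circular_cone_normal K y (U : 'rV[R]_3) (c t : R) : cone_directrix K y ->
  dot U U = 1 -> (forall t, K t -> dot (y t) U = c) -> K t ->
  [/\ dot (cone_normal y t) (cone_normal y t) = 1,
      dot (y t) (cone_normal y t) = 0
    & dot (cone_normal y t) U ^+ 2 = 1 - c ^+ 2].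
Proof.
move=> [[_ K_open _] [y_smooth y1_neq0] y_unit] UU yU Kt.
have dy := smooth_on_derive y_smooth Kt.
have yy s : K s -> dot (y s) (y s) = 1 by move=> /y_unit /enorm1P.
have yy1 := dot_const_orth K_open yy Kt dy.
have Uy1 : dot U (derive1 y t) = 0.
  have cyU s : K s -> c = dot (y s) U by move=> /yU.
  have := is_derive_unique (is_derive_dot dy (is_derive_cst U t 1))
    (is_derive_eq_in K_open Kt cyU (is_derive_cst c t 1)).
  by rewrite dotv0 addr0 dotC.
have y1y1_gt0 : 0 < dot (derive1 y t) (derive1 y t) by rewrite dot_gt0 y1_neq0.
pose p := cross (y t) (derive1 y t).
have pp : dot p p = dot (derive1 y t) (derive1 y t).
  by rewrite dot_cross_cross yy // yy1 mul1r expr0n subr0.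
have p_gt0 : 0 < enorm p by rewrite enorm_gt0 -dot_gt0 pp.
have normal_sqr v : dot (cone_normal y t) v ^+ 2 = dot p v ^+ 2 / dot p p.
  by rewrite dotZl exprMn exprVn enorm_sqr mulrC.
split.
- rewrite dotZl dotZr -enorm_sqr; field; exact: lt0r_neq0.
- by rewrite dotZr dot_crossl mulr0.
- rewrite normal_sqr (dotC p) gram_det UU Uy1 yy1 yy // (dotC U) yU // pp.
  by field; exact: lt0r_neq0.
Qed.

Lemma cone_geodesic_rectifying_slant J b K y : open_interval J ->
  positive_curvature J b -> circular_cone K y -> cone_geodesic K y J b ->
  rectifying J b /\ slant_helix J b.
Proof.
move=> [[s0 Js0] J_open J_itv] k_gt0 [y_cone [U [psi [U1 psi_itv yU]]]].
move=> [b_unit [u [t [_ _ bE b2E]]]].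
have UU : dot U U = 1 by exact/enorm1P.
have normalP s (Js : J s) :=
  let: And3 _ Kts _ := bE s Js in circular_cone_normal y_cone UU yU Kts.
have b2b s : J s -> dot (b s) (derive1n 2 b s) = 0.
  move=> Js; have [c ->] := b2E s Js; have [_ yN _] := normalP s Js.
  by have [_ _ ->] := bE s Js; rewrite dotZl dotZr yN !mulr0.
split.
  split; [exact: b_unit | exact: k_gt0 | move=> s Js].
  have b2_orth := unit_speed_orth J_open b_unit Js.
  (* The frame is tangent, principal normal, binormal; the normal component vanishes since <b, b''>
     = 0. *)
  eexists; eexists; apply: orthonormal_expansion.
  - exact: unit_speed_dot b_unit Js.
  - rewrite dotZl dotZr -curvature_sqr; field; exact/lt0r_neq0/k_gt0.
  - by rewrite dotZr b2_orth mulr0.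
  - by rewrite dotZr b2b // mulr0.
split; [exact: b_unit | by move=> s Js; exact/lt0r_neq0/k_gt0 |].
exists U, (dot (principal_normal b s0) U); split; first exact: U1.
move=> s Js.
(* The factor between b'' and the cone normal is not known to keep its sign, so only squares are
   computed; the continuous function [g] will fix the sign of <n, U>. *)
pose g s := dot (derive1n 2 b s) U.
have g_sqr r : J r -> g r ^+ 2 = curvature b r ^+ 2 * sin psi ^+ 2.
  move=> Jr; rewrite curvature_sqr /g; have [c ->] := b2E r Jr.
  have [NN _ NU] := normalP r Jr.
  rewrite !(dotZl c) (dotZr c) exprMn NU NN.
  by rewrite mulr1 -(cos2Dsin2 psi); ring.
(* This keeps [g] away from zero, as the sign argument requires. *)
have sin_neq0 : sin psi != 0.
  case/andP: psi_itv => psi_gt0 psi_lt; rewrite gt_eqF // sin_gt0_pi //.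
  rewrite psi_gt0 /= (lt_le_trans psi_lt) // ler_pdivrMr // ler_peMr ?pi_ge0 //.
  by rewrite ler1n.
have g_cont r : J r -> {for r, continuous g}.
  move=> Jr; have [b_smooth _] := b_unit.
  have := is_derive_dot (smooth_on_derive (smooth_on_derive1
    (smooth_on_derive1 b_smooth)) Jr) (is_derive_cst U r 1).
  exact: is_derive1_continuous.
have nE r : J r -> dot (principal_normal b r) U = g r / curvature b r.
  by move=> Jr; rewrite dotZl mulrC.
have n_sqr r : J r -> dot (principal_normal b r) U ^+ 2 = sin psi ^+ 2.
  move=> Jr; rewrite nE // expr_div_n g_sqr // mulrAC divff ?mul1r //.
  by rewrite sqrf_eq0; exact/lt0r_neq0/k_gt0.
apply: (constant_of_sqr J_itv g_cont _ n_sqr Js Js0) => r Jr.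
rewrite (nE r Jr) mulrA -expr2 (g_sqr r Jr) mulr_gt0 ?invr_gt0 ?k_gt0 //.
by rewrite -exprMn exprn_even_gt0 //= mulf_neq0 //; exact/lt0r_neq0/k_gt0.
Qed.

End Curves.

(** * Rectifying curves and the cone over their projection to the unit sphere *)

Section RectifyingCurve.
Context {R : realType} (J : set R) (b : R -> 'rV[R]_3).
Context (J_itv : open_interval J) (b_rect : rectifying J b).

Let b_unit : unit_speed J b. Proof. by case: b_rect. Qed.

Let J_open : open J. Proof. by case: J_itv. Qed.

Let b2_neq0 s : J s -> derive1n 2 b s != 0.
Proof. by case: b_rect => _ k_gt0 _ /k_gt0; rewrite curvature_gt0. Qed.

Let q s := dot (b s) (b s).

Let x s := dot (b s) (derive1 b s).

Let p s := cross (b s) (derive1 b s).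

Lemma rectifying_dot s : J s -> dot (b s) (derive1n 2 b s) = 0.
Proof.
move=> Js; have [_ _ /(_ s Js)[l [m ->]]] := b_rect.
rewrite dotDl !dotZl (unit_speed_orth J_open b_unit Js) mulr0 add0r.
by rewrite /binormal crossZr dotZl dotC dot_crossr !mulr0.
Qed.

Let is_derive_x s : J s -> is_derive s 1 x 1.
Proof.
move=> Js; have [db db1] := unit_speed_derive b_unit Js.
apply: is_derive_eq (is_derive_dot db db1) _.
by rewrite rectifying_dot // addr0 (unit_speed_dot b_unit Js).
Qed.

Let is_derive_q s : J s -> is_derive s 1 q (2 * x s).
Proof.
move=> Js; have [db _] := unit_speed_derive b_unit Js.
apply: is_derive_eq (is_derive_dot db db) _.
by rewrite (dotC (derive1 b s)) -/(x s); ring.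
Qed.

Let pp s : J s -> dot (p s) (p s) = q s - x s ^+ 2.
Proof.
by move=> Js; rewrite dot_cross_cross (unit_speed_dot b_unit Js) mulr1.
Qed.

(** By Lagrange's identity and unit speed |b x b'|^2 = q - x^2, whose derivative is 2 x - 2 x =
    0. *)
Lemma rectifying_cross_norm_constant s t : J s -> J t ->
  dot (cross (b s) (derive1 b s)) (cross (b s) (derive1 b s)) =
  dot (cross (b t) (derive1 b t)) (cross (b t) (derive1 b t)).
Proof.
move=> Js Jt; rewrite [LHS](pp Js) [RHS](pp Jt).
have [_ _ J_int] := J_itv.
apply: (@constant_on_interval R J (q - x * x)) => // r Jr.
apply: is_derive_eq.
  exact: is_deriveB (is_derive_q Jr)
    (is_deriveM (is_derive_x Jr) (is_derive_x Jr)).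
by rewrite /GRing.scale /=; ring.
Qed.

(* If b x b' vanished at one point it would vanish everywhere; then b = x b',
   and differentiating gives x b'' = 0, hence x = 0, against x' = 1. *)
Lemma rectifying_cross_neq0 s : J s -> cross (b s) (derive1 b s) != 0.
Proof.
move=> Js; rewrite -/(p s); apply/negP => /eqP p0.
have q_eq t : J t -> q t = x t ^+ 2.
  move=> Jt; apply/eqP; rewrite -subr_eq0 -pp //.
  by rewrite (rectifying_cross_norm_constant Jt Js) -/(p s) p0 dotv0.
have b_eq t : J t -> x t *: derive1 b t = b t.
  move=> Jt; apply/esym/eqP; rewrite -subr_eq0 -dot_eq0; apply/eqP.
  rewrite !(dotDl, dotDr, dotNl, dotNr, dotZl, dotZr).
  rewrite (dotC (derive1 b t) (b t)) -/(x t) -/(q t) q_eq //.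
  by rewrite (unit_speed_dot b_unit Jt); ring.
have x0 t : J t -> 0 = x t.
  move=> Jt; have [db db1] := unit_speed_derive b_unit Jt.
  have := is_derive_unique db
    (is_derive_eq_in J_open Jt b_eq (is_derive_scale (is_derive_x Jt) db1)).
  rewrite scale1r addrC -{1}[derive1 b t]addr0 => /addrI /esym /eqP.
  by rewrite scaler_eq0 (negPf (b2_neq0 Jt)) orbF => /eqP.
have := is_derive_unique (is_derive_x Js)
  (is_derive_eq_in J_open Js x0 (is_derive_cst 0 s 1)).
by move/eqP; rewrite oner_eq0.
Qed.

Let pp_gt0 s : J s -> 0 < dot (p s) (p s).
Proof. by move=> /rectifying_cross_neq0; rewrite dot_gt0. Qed.

Let q_gt0 s : J s -> 0 < q s.
Proof.
move=> Js; have := pp_gt0 Js; rewrite pp // subr_gt0.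
exact/le_lt_trans/sqr_ge0.
Qed.

Let r s := (Num.sqrt (q s))^-1.

Let r_gt0 s : J s -> 0 < r s.
Proof. by move=> /q_gt0; rewrite invr_gt0 sqrtr_gt0. Qed.

Let r_sqr s : J s -> r s ^+ 2 * q s = 1.
Proof.
move=> /q_gt0 qs.
by rewrite exprVn sqr_sqrtr ?(ltW qs) // mulVf ?lt0r_neq0.
Qed.

Let y s := r s *: b s.

(** The quotient rule for b / |b| gives |b|^(-3) (<b, b> b' - <b, b'> b), and the bracket is the
    double product (b x b') x b. *)
Let is_derive_y s : J s -> is_derive s 1 y (r s ^+ 3 *: cross (p s) (b s)).
Proof.
move=> Js; have [db _] := unit_speed_derive b_unit Js.
have dr := is_derive_rsqrt (q_gt0 Js) (is_derive_q Js).
apply: is_derive_eq (is_derive_scale dr db) _.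
rewrite /p cross_crossl (dotC _ (b s)) -/(q s) -/(x s) scalerBr !scalerA.
rewrite -/(r s).
congr (_ *: _ + _).
  by rewrite -[LHS]mulr1 -(r_sqr Js); ring.
by rewrite -scaleNr; congr (_ *: _); field.
Qed.

Let derive1_y s : J s -> derive1 y s = r s ^+ 3 *: cross (p s) (b s).
Proof. by move=> /is_derive_y[_ <-]; rewrite derive1E. Qed.

(** The component of y' along b drops out, so the cone normal is parallel to p. *)
Let cross_y s : J s -> cross (y s) (derive1 y s) = r s ^+ 2 *: p s.
Proof.
move=> Js; rewrite derive1_y // /p cross_crossl crossZl crossZr.
rewrite -scaleNr crossDr !crossZr crossvv scaler0 addr0 !scalerA.
congr (_ *: _); rewrite (_ : r s * _ * _ = r s ^+ 2 * (r s ^+ 2 * q s)).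
  by rewrite r_sqr // mulr1.
by rewrite -/(q s); ring.
Qed.

Let cross_y_neq0 s : J s -> cross (y s) (derive1 y s) != 0.
Proof.
move=> Js; rewrite cross_y // scaler_eq0 negb_or rectifying_cross_neq0 // andbT.
by rewrite expf_neq0 // lt0r_neq0 // r_gt0.
Qed.

Let smooth_q : smooth_on J q.
Proof.
apply: (smooth_on_deriveP J_open is_derive_q).
apply: (@smooth_onZ _ R J (fun=> 2) x J_open); first exact: smooth_on_cst.
by apply: (smooth_on_deriveP J_open is_derive_x); exact: smooth_on_cst.
Qed.

Let smooth_r : smooth_on J r.
Proof. exact: smooth_on_rsqrt J_open q_gt0 smooth_q. Qed.

Let yy s : J s -> dot (y s) (y s) = 1.
Proof. by move=> Js; rewrite dotZl dotZr mulrA -expr2 r_sqr. Qed.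

Let derive1_y_neq0 s : J s -> derive1 y s != 0.
Proof.
move=> Js; apply: contraNneq (cross_y_neq0 Js) => ->.
by rewrite crossC cross0v oppr0.
Qed.

Lemma rectifying_cone_directrix :
  cone_directrix J (fun s => (Num.sqrt (dot (b s) (b s)))^-1 *: b s).
Proof.
split=> //; last by move=> s /yy /enorm1P.
split; last exact: derive1_y_neq0.
by apply: (smooth_onZ J_open smooth_r); case: b_unit.
Qed.

(** The acceleration is orthogonal to both b and b', whose cross product p is nonzero. *)
Let b2E s : J s -> exists2 k, k != 0 & derive1n 2 b s = k *: p s.
Proof.
move=> Js; have := pp_gt0 Js => ps.
have := orthogonal_frame (rectifying_dot Js) (unit_speed_orth J_open b_unit Js).
rewrite -/(p s) => /(congr1 (fun v => (dot (p s) (p s))^-1 *: v)).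
rewrite !scalerA mulVf ?lt0r_neq0 // scale1r; move: (_ * _) => k b2E.
exists k => //; apply: contraNneq (b2_neq0 Js) => k0.
by rewrite b2E k0 scale0r.
Qed.

Lemma rectifying_cone_geodesic :
  cone_geodesic J (fun s => (Num.sqrt (dot (b s) (b s)))^-1 *: b s) J b.
Proof.
(* The distance |b| is written as q r, a product of functions already known to be smooth; the
   directrix has the same parameter as the curve. *)
split=> //; exists (fun s => q s * r s), (fun s => s); split.
- exact: (@smooth_onZ _ R).
- exact: smooth_on_id.
- move=> s Js; split=> //; first by rewrite mulr_gt0 ?q_gt0 ?r_gt0.
  rewrite /cone -/(q s) -/(r s) scalerA -mulrA -expr2 mulrC r_sqr //.
  by rewrite scale1r.
- move=> s Js; have [k k_neq0 ->] := b2E Js.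
  rewrite /cone_normal -/y cross_y //.
  have e_gt0 : 0 < enorm (r s ^+ 2 *: p s)
    by rewrite enorm_gt0 -cross_y // cross_y_neq0.
  exists (k * enorm (r s ^+ 2 *: p s) / r s ^+ 2).
  rewrite !scalerA; congr (_ *: _); field.
  by rewrite (lt0r_neq0 e_gt0) (lt0r_neq0 (r_gt0 Js)).
Qed.

(** Since b'' = k p with k of unknown sign, the slant condition only gives <p, U>^2 = c^2 |p|^2,
    which is constant. This suffices for <p, U>' = 0, and that derivative is a nonzero multiple of
    the product in question. *)
Lemma rectifying_slant_directrix_orth (U : 'rV[R]_3) (c : R) :
  (forall s, J s -> dot (principal_normal b s) U = c) ->
  forall s, J s -> dot (cross (cross (b s) (derive1 b s)) (b s)) U = 0.
Proof.
move=> nU s Js; pose f t := dot (p t) U.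
have b2U t : J t -> dot (derive1n 2 b t) U = c * curvature b t.
  move=> Jt; rewrite -(nU t Jt) dotZl mulrAC mulVf ?mul1r //.
  by rewrite lt0r_neq0 // curvature_gt0 b2_neq0.
have f_sqr t : J t -> f t ^+ 2 = c ^+ 2 * dot (p t) (p t).
  move=> Jt; have [k k_neq0 b2k] := b2E Jt.
  apply: (mulfI (expf_neq0 2 k_neq0)).
  rewrite -exprMn -(dotZl k) -b2k (b2U t Jt).
  by rewrite exprMn curvature_sqr b2k dotZl dotZr; ring.
have df t : J t -> is_derive t 1 f (dot (cross (b t) (derive1n 2 b t)) U).
  move=> Jt; have [db db1] := unit_speed_derive b_unit Jt.
  apply: is_derive_eq
    (is_derive_dot (is_derive_cross db db1) (is_derive_cst U t 1)) _.
  by rewrite dotv0 addr0 crossvv add0r.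
clearbody f; have f2_const t : J t -> f s ^+ 2 = f t ^+ 2.
  move=> Jt; apply: etrans (f_sqr s Js) (etrans _ (esym (f_sqr t Jt))).
  by apply: congr1; exact: rectifying_cross_norm_constant Js Jt.
have ff'0 : f s * dot (cross (b s) (derive1n 2 b s)) U = 0.
  have f2C t : J t -> f s ^+ 2 = (f * f) t by move=> /f2_const ->.
  have := is_derive_unique (is_deriveM (df s Js) (df s Js))
    (is_derive_eq_in J_open Js f2C (is_derive_cst (f s ^+ 2) s 1)).
  by rewrite /GRing.scale /= -mulr2n => /eqP; rewrite mulrn_eq0 => /eqP.
(* If f vanishes at s, its constant square is 0, so f vanishes on all of [J] and its derivative is
   again 0. *)
have f'0 : dot (cross (b s) (derive1n 2 b s)) U = 0.
  move/eqP: ff'0; rewrite mulf_eq0 => /orP[/eqP fs0|/eqP //].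
  have f0 t : J t -> 0 = f t.
    move=> /f2_const /esym /eqP.
    by rewrite fs0 expr0n /= sqrf_eq0 => /eqP.
  exact: is_derive_unique (df s Js)
    (is_derive_eq_in J_open Js f0 (is_derive_cst 0 s 1)).
have [k k_neq0 b2k] := b2E Js; move: f'0.
rewrite b2k crossZr crossC scalerN dotNl dotZl => /eqP.
by rewrite oppr_eq0 mulf_eq0 (negPf k_neq0) => /eqP.
Qed.

(** As y' is orthogonal to U, <y, U> is a constant d. An angle strictly between 0 and pi/2 further
    requires 0 < |d| < 1. *)
Lemma rectifying_slant_circular_cone : slant_helix J b ->
  circular_cone J (fun s => (Num.sqrt (dot (b s) (b s)))^-1 *: b s).
Proof.
move=> [_ _ [U [c [U1 nU]]]]; split; first exact: rectifying_cone_directrix.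
have UU : dot U U = 1 by exact/enorm1P.
have [[s Js] _ J_int] := J_itv.
have y1U t : J t -> dot (derive1 y t) U = 0.
  move=> Jt; rewrite derive1_y // dotZl.
  by rewrite (rectifying_slant_directrix_orth nU Jt) mulr0.
pose d := dot (y s) U.
have yU t : J t -> dot (y t) U = d.
  move=> Jt; apply: (@constant_on_interval _ _ (fun t => dot (y t) U) _ _ J_int _ Jt
    Js).
  move=> z Jz.
  apply: is_derive_eq (is_derive_dot (is_derive_y Jz) (is_derive_cst U z 1)) _.
  by rewrite -derive1_y // y1U // dotv0 addr0.
have yy1 : dot (y s) (derive1 y s) = 0.
  apply: (dot_const_orth J_open yy Js).
  by rewrite derive1_y //; exact: is_derive_y.
have y1y1_gt0 : 0 < dot (derive1 y s) (derive1 y s).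
  by rewrite dot_gt0 derive1_y_neq0.
(* The Gram determinant of y, y', U equals (1 - d^2) |y'|^2 and is a square. *)
have d2_le1 : d ^+ 2 <= 1.
  have := sqr_ge0 (dot U (cross (y s) (derive1 y s))).
  rewrite gram_det UU (yy Js) yy1 (dotC U (derive1 y s)) y1U // (dotC U) -/d.
  rewrite !(mul1r, mulr0, mul0r, expr0n, mul0rn, addr0, subr0) /=.
  by rewrite -{1}[dot (derive1 y s) _]mul1r -mulrBl pmulr_lge0 // subr_ge0.
(* Equality in the Cauchy-Schwarz inequality would make y the constant d U, against y' != 0. *)
have d2_neq1 : d ^+ 2 != 1.
  apply/eqP => d2; have yE t : J t -> d *: U = y t.
    move=> Jt; move: (y t) (yU t Jt) (yy Jt) => v vU vv.
    apply/eqP; rewrite -subr_eq0 -dot_eq0; apply/eqP.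
    rewrite !(dotDl, dotDr, dotNl, dotNr, dotZl, dotZr) (dotC U v) vU vv UU.
    by ring: d2.
  have := is_derive_unique (is_derive_y Js)
    (is_derive_eq_in J_open Js yE (is_derive_cst (d *: U) s 1)).
  by rewrite -derive1_y // => /eqP; rewrite (negPf (derive1_y_neq0 Js)).
(* Otherwise b lies in the plane orthogonal to U, and so do b' and b'', hence also p. The Gram
   determinant of b, b', U then reads 0 = |p|^2, a contradiction. *)
have d_neq0 : d != 0.
  apply/eqP => d0; have bU t : J t -> 0 = dot (b t) U.
    move=> Jt; have := yU t Jt; rewrite d0 dotZl => /eqP.
    by rewrite mulf_eq0 (negPf (lt0r_neq0 (r_gt0 Jt))) => /eqP.
  have b1U t : J t -> 0 = dot (derive1 b t) U.
    move=> Jt; have [db _] := unit_speed_derive b_unit Jt.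
    have := is_derive_unique (is_derive_dot db (is_derive_cst U t 1))
      (is_derive_eq_in J_open Jt bU (is_derive_cst 0 t 1)).
    by rewrite dotv0 addr0.
  have b2U : dot (derive1n 2 b s) U = 0.
    have [_ db1] := unit_speed_derive b_unit Js.
    have := is_derive_unique (is_derive_dot db1 (is_derive_cst U s 1))
      (is_derive_eq_in J_open Js b1U (is_derive_cst 0 s 1)).
    by rewrite dotv0 addr0.
  have pU : dot U (p s) = 0.
    have [k k_neq0 b2k] := b2E Js; move/eqP: b2U.
    by rewrite b2k dotZl mulf_eq0 (negPf k_neq0) dotC => /eqP.
  have /eqP := gram_det (b s) (derive1 b s) U.
  rewrite -/(p s) pU (dotC U (b s)) -bU // (dotC U (derive1 b s)) -b1U // UU.
  rewrite !(mul1r, mulr0, mul0r, expr0n, mul0rn, addr0, subr0) /=.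
  by rewrite -dot_cross_cross -/(p s) eq_sym gt_eqF // pp_gt0.
have d_lt1 : `|d| < 1.
  rewrite -(@ltr_pXn2r _ 2) ?nnegrE // expr1n real_normK ?num_real //.
  by rewrite lt_neqAle d2_neq1.
have abs_itv : -1 <= `|d| <= 1.
  by rewrite (ltW d_lt1) (le_trans _ (normr_ge0 d)) // oppr_le0 ler01.
have cosE : cos (acos `|d|) = `|d| by rewrite acosK // in_itv.
(* The axis is reversed when d < 0, which makes the angle acute. *)
exists (Num.sg d *: U), (acos `|d|); split.
- apply/enorm1P; rewrite dotZl dotZr UU mulr1 -expr2 sqr_sg d_neq0 //.
- rewrite acos_gt0 ?d_lt1 ?(proj1 (andP abs_itv)) //=.
  rewrite -ltr_cos ?in_itv /= ?acos_ge0 ?acos_lepi // ?cos_pihalf ?cosE.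
    by rewrite normr_gt0.
  by rewrite divr_ge0 ?pi_ge0 // ler_pdivrMr // ler_peMr ?pi_ge0 // ler1n.
- move=> t Jt; rewrite dotZr -/(q t) -/(r t) -/(y t) yU // cosE.
  by rewrite normrEsg.
Qed.

End RectifyingCurve.

(** * The equivalence for regular curves, through their arc length reparametrizations *)

Theorem theorem3p5 (R : realType) (I : set R) (alpha : R -> 'rV[R]_3)
    (I_open_interval : open_interval I)
    (alpha_regular : regular_curve I alpha)
    (alpha_curvature : by_arc_length (@positive_curvature R) I alpha) :
  (exists (K : set R) (y : R -> 'rV[R]_3),
      circular_cone K y /\ by_arc_length (cone_geodesic K y) I alpha) <->
  (by_arc_length (@rectifying R) I alpha /\
   by_arc_length (@slant_helix R) I alpha).
Proof.
have [alpha_smooth _] := alpha_regular; split.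
- move=> [K [y [y_cone [J [phi [phiP phi_unit phi_geo]]]]]].
  have [J' [psi [psiP psi_unit k_gt0]]] := alpha_curvature.
  have J_itv : open_interval J by case: phiP.
  (* Positive curvature is given for [psi] and has to be moved to the parameter [phi] of the
     geodesic. *)
  have k'_gt0 : positive_curvature J (alpha \o phi).
    move=> s Js; have [s' Js' eq2] := arc_length_transfer alpha_smooth phiP
      phi_unit psiP psi_unit Js.
    by rewrite curvature_gt0 eq2 -curvature_gt0; exact: k_gt0.
  have [rect slant] :=
    cone_geodesic_rectifying_slant J_itv k'_gt0 y_cone phi_geo.
  by split; exists J, phi.
- move=> [[J [phi [phiP phi_unit rect]]] [J' [psi [psiP psi_unit slant]]]].
  have J_itv : open_interval J by case: phiP.
  (* The two hypotheses may come with different reparametrizations; the slant property is moved to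
     that of the rectifying one. *)
  have slant' : slant_helix J (alpha \o phi).
    have transfer :=
      arc_length_transfer alpha_smooth phiP phi_unit psiP psi_unit.
    have [_ _ [U [c [U1 nU]]]] := slant.
    split; first exact: phi_unit.
      by move=> s Js; have [_ k_gt0 _] := rect; exact/lt0r_neq0/k_gt0.
    exists U, c; split; first exact: U1.
    move=> s Js; have [s' Js' eq2] := transfer s Js; rewrite -(nU s' Js').
    by rewrite /principal_normal /curvature eq2.
  exists J, (fun s => (Num.sqrt (dot ((alpha \o phi) s) ((alpha \o phi) s)))^-1
                        *: (alpha \o phi) s); split.
    exact: rectifying_slant_circular_cone.
  by exists J, phi; split; [| | exact: rectifying_cone_geodesic].
Qed.
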